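(* Let $1<p<\infty$, let $r,s$ be (real or complex) numbers, and let $U(s,r,s)$ be the bounded linear operator on $\ell_p$ defined by the symmetric tri-band matrix with $r$ on the main diagonal and $s$ on the first super- and sub-diagonals. Then the point spectrum of $U(s,r,s)$ on $\ell_p$ is empty: $$\sigma_p\left(U(s,r,s),\ell_p\right)=\varnothing .$$
   Context: $\mathbb{N}=\{0,1,2,\dots\}$. $\ell_p$ is the complex Banach space of sequences $x=(x_k)_{k\in\mathbb{N}}$ with $\sum_k|x_k|^p<\infty$, with its usual norm. The operator $U(s,r,s)$ acts by $(U(s,r,s)x)_k=sx_{k-1}+rx_k+sx_{k+1}$ for $k\in\mathbb{N}$, with the convention $x_{-1}=0$. For a bounded linear operator $T$ on a complex Banach space $X$, the point spectrum $\sigma_p(T,X)$ is the set of all $\lambda\in\mathbb{C}$ for which $(T-\lambda I)^{-1}$ does not exist, i.e. $T-\lambda I$ is not injective on $X$ (the set of eigenvalues of $T$). (The subscript $p$ in $\sigma_p$ stands for ''point'' and is unrelated to the exponent $p$.)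
   Formalization: The formal theorem assumes s ≠ 0; for s = 0 the operator is r times the identity, whose point spectrum is {r}, so the statement as written fails in that case. *)

(* Defs.v *)
From HB Require Import structures.
From mathcomp Require Import all_boot all_order all_algebra.
From mathcomp Require Import complex.
From mathcomp Require Import all_classical all_reals all_analysis.
From mathcomp Require Import ring.

Set Implicit Arguments.
Unset Strict Implicit.
Unset Printing Implicit Defensive.

Import Order.TTheory GRing.Theory Num.Theory.
Import numFieldNormedType.Exports.
Import Normc.

Local Open Scope classical_set_scope.
Local Open Scope ring_scope.
Local Open Scope complex_scope.

Section ellp.
Context {R : realType}.
Implicit Types (p : R) (x y : nat -> R[i]^o).

(* The sum of |x_k|^p, possibly +oo; [normc] is the R-valued modulus on R[i]
   (the generic norm `|z| of z : R[i] is R[i]-valued). *)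
Definition pow_sum p x : \bar R :=
  (\sum_(0 <= k <oo) (normc (x k) `^ p)%:E)%E.

Definition ellp_pred p : {pred nat -> R[i]^o} :=
  [pred x | (pow_sum p x < +oo)%E].

Lemma pow_sum_ge0 p x : (0 <= pow_sum p x)%E.
Proof. by apply: nneseries_ge0 => k _ _; rewrite lee_fin powR_ge0. Qed.

Lemma normc_ge0 (z : R[i]) : 0 <= normc z.
Proof. by case: z => a b; rewrite /normc sqrtr_ge0. Qed.

Lemma normc_normE (z : R[i]) : (normc z)%:C = `|z|.
Proof. by []. Qed.

Lemma normc_le (z t : R[i]) : normc (z + t) <= normc z + normc t.
Proof. by rewrite -lecR rmorphD/=; exact: (@ler_normD _ R[i]). Qed.

Definition normp p x : R := fine (pow_sum p x) `^ p^-1.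

Lemma pow_sum_Lnorm p x : 0 < p ->
  (pow_sum p x `^ p^-1 =
   'N[counting : {measure set nat -> \bar R}]_p%:E[EFin \o (fun k => normc (x k))])%E.
Proof.
move=> p0; rewrite Lnorm_counting//; congr (_ `^ _)%E.
by apply: eq_eseriesr => k _ /=; rewrite ger0_norm ?normc_ge0.
Qed.

Lemma normp_le p x y : 0 < p -> (pow_sum p x <= pow_sum p y)%E ->
  y \in ellp_pred p -> normp p x <= normp p y.
Proof.
rewrite inE => p0 xy fy; rewrite /normp.
apply: ge0_ler_powR; rewrite ?nnegrE ?fine_ge0 ?pow_sum_ge0//.
  by rewrite invr_ge0 ltW.
by apply: fine_le; rewrite // ge0_fin_numE ?pow_sum_ge0//; exact: le_lt_trans fy.
Qed.

Lemma normpE p x : x \in ellp_pred p ->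
  (normp p x)%:E = (pow_sum p x `^ p^-1)%E.
Proof.
rewrite inE => fx; rewrite /normp -poweR_EFin fineK//.
by rewrite ge0_fin_numE// pow_sum_ge0.
Qed.

Lemma pow_sum_lty p x : 0 < p ->
  (pow_sum p x < +oo)%E = (pow_sum p x `^ p^-1 < +oo)%E.
Proof.
move=> p0; have := pow_sum_ge0 p x.
case: (pow_sum p x) => [r r0|_|//].
- by rewrite poweR_EFin !ltry.
- by rewrite poweRyr ?invr_neq0 ?gt_eqF// ltxx.
Qed.

Lemma minkowski_seq p x y : 1 <= p ->
  (pow_sum p (x + y)%R `^ p^-1 <= pow_sum p x `^ p^-1 + pow_sum p y `^ p^-1)%E.
Proof.
move=> p1; have p0 : 0 < p by rewrite (lt_le_trans _ p1).
rewrite !pow_sum_Lnorm//.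
apply: le_trans (@eminkowski _ _ _ _ (fun k => normc (x k))
   (fun k => normc (y k)) p%:E _ _ _) => //.
rewrite !Lnorm_counting//; apply: gt0_ler_poweR.
- by rewrite invr_ge0 ltW.
- by rewrite in_itv/= leey andbT; apply: nneseries_ge0 => k _ _; rewrite lee_fin powR_ge0.
- by rewrite in_itv/= leey andbT; apply: nneseries_ge0 => k _ _; rewrite lee_fin powR_ge0.
apply: lee_nneseries => [k _ _|k _]; first exact: poweR_ge0.
rewrite /= lee_fin; apply: ge0_ler_powR; rewrite ?nnegrE//; first exact: ltW.
by rewrite !ger0_norm ?addr_ge0 ?normc_ge0//; exact: normc_le.
Qed.

Lemma pow_sumZ p (a : R[i]) x :
  pow_sum p (a *: x) = ((normc a `^ p)%:E * pow_sum p x)%E.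
Proof.
rewrite /pow_sum -nneseriesZl//; last by move=> k _; rewrite lee_fin powR_ge0.
apply: eq_eseriesr => k _.
by rewrite -EFinM -powRM ?normc_ge0// -normcM.
Qed.

Lemma ellp_submod_closed p : 1 <= p -> submod_closed (ellp_pred p).
Proof.
move=> p1; have p0 : 0 < p by rewrite (lt_le_trans _ p1).
split=> [|a x y].
  rewrite inE /pow_sum eseries0 ?ltry// => k _ _.
  by rewrite normc0 powR0// gt_eqF.
rewrite !inE => fx fy; rewrite pow_sum_lty//.
apply: le_lt_trans (minkowski_seq _ _ p1) _.
rewrite lte_add_pinfty//; last by rewrite -pow_sum_lty.
rewrite -(pow_sum_lty (a *: x) p0) pow_sumZ; apply: lte_mul_pinfty => //.
by rewrite lee_fin powR_ge0.
Qed.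

Lemma normpD p x y : 1 <= p -> x \in ellp_pred p -> y \in ellp_pred p ->
  x + y \in ellp_pred p -> normp p (x + y) <= normp p x + normp p y.
Proof.
move=> p1 fx fy fxy; have := minkowski_seq x y p1.
by rewrite -(normpE fx) -(normpE fy) -(normpE fxy) -EFinD lee_fin.
Qed.

Lemma normpZ p (a : R[i]) x : 0 < p -> x \in ellp_pred p ->
  normp p (a *: x) = normc a * normp p x.
Proof.
rewrite inE => p0 x_fin; have fx : pow_sum p x \is a fin_num.
  by rewrite ge0_fin_numE ?pow_sum_ge0.
rewrite /normp pow_sumZ fineM// powRM ?powR_ge0 ?fine_ge0 ?pow_sum_ge0//.
by rewrite -powRrM mulfV ?gt_eqF// powRr1 ?normc_ge0.
Qed.

Lemma normp_eq0 p x : x \in ellp_pred p -> normp p x = 0 -> x = 0.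
Proof.
rewrite inE => x_fin /eqP; rewrite /normp powR_eq0 => /andP[/eqP x0 _].
have fx : pow_sum p x \is a fin_num by rewrite ge0_fin_numE ?pow_sum_ge0.
have {}x0 : pow_sum p x = 0%E by rewrite -(fineK fx) x0.
apply/funext => k; apply: eq0_normc; apply/eqP.
have : ((normc (x k) `^ p)%:E <= 0)%E.
  rewrite -x0 /pow_sum (@nneseriesD1 _ _ k)//; last by move=> i _; rewrite lee_fin powR_ge0.
  by rewrite leeDl// nneseries_ge0// => i _ _; rewrite lee_fin powR_ge0.
by rewrite lee_fin le_eqVlt ltNge powR_ge0 orbF powR_eq0 => /andP[].
Qed.

End ellp.

(* The space ell_p; the proof of 1 <= p is a parameter of the type so that its
   vector space and norm structures can be inferred. *)
Record ellp (R : realType) (p : R) (p1 : 1 <= p) : Type := Ellp {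
  ellp_seq :> nat -> R[i]^o;
  _ : ellp_seq \in ellp_pred p
}.

Section ellp_structures.
Context {R : realType} (p : R) (p1 : 1 <= p).
Let p0 : 0 < p. Proof. by rewrite (lt_le_trans _ p1). Qed.

HB.instance Definition _ := [isSub for @ellp_seq R p p1].
HB.instance Definition _ := [Choice of ellp p1 by <:].
HB.instance Definition _ :=
  GRing.isSubmodClosed.Build R[i] (nat -> R[i]^o) (ellp_pred p)
    (ellp_submod_closed p1).
HB.instance Definition _ := [SubChoice_isSubLmodule of ellp p1 by <:].

Definition ellp_norm (x : ellp p1) : R[i] := (normp p x)%:C.

Lemma ellp_normD (x y : ellp p1) :
  ellp_norm (x + y) <= ellp_norm x + ellp_norm y.
Proof.
have fx := valP x; have fy := valP y; have fxy := valP (x + y).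
suff h : normp p (\val (x + y)) <= normp p (\val x) + normp p (\val y).
  by rewrite -lecR rmorphD in h.
exact: (normpD p1 fx fy fxy).
Qed.

Lemma ellp_normZ (a : R[i]) (x : ellp p1) :
  ellp_norm (a *: x) = `|a| * ellp_norm x.
Proof.
have h := normpZ a p0 (valP x).
by rewrite -normc_normE -[RHS](rmorphM (real_complex R)) -h.
Qed.

Lemma ellp_norm_eq0 (x : ellp p1) : ellp_norm x = 0 -> x = 0.
Proof.
move=> x0; apply: val_inj; apply: (normp_eq0 (valP x)).
exact: (congr1 (@complex.Re R) x0).
Qed.

HB.instance Definition _ := @Lmodule_isNormed.Build R[i] (ellp p1)
  ellp_norm ellp_normD ellp_normZ ellp_norm_eq0.

End ellp_structures.

Section triband.
Context {R : realType} (p : R) (p1 : 1 <= p).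
Let p0 : 0 < p. Proof. by rewrite (lt_le_trans _ p1). Qed.

(* The matrix U(s, r, s): r on the diagonal, s just above and just below, with
   the convention x_{-1} = 0. *)
Definition triband_seq (s r : R[i]) (x : nat -> R[i]^o) : nat -> R[i]^o :=
  fun k => s * (if k is j.+1 then x j else 0) + r * x k + s * x k.+1.

Let shiftr (x : nat -> R[i]^o) : nat -> R[i]^o :=
  fun k => if k is j.+1 then x j else 0.

Let shiftl (x : nat -> R[i]^o) : nat -> R[i]^o := fun k => x k.+1.

Let triband_seqE s r x :
  triband_seq s r x = s *: shiftr x + (r *: x + s *: shiftl x).
Proof. by apply/funext => k; rewrite /triband_seq -addrA. Qed.

Let pow_sum_shiftr x : pow_sum p (shiftr x) = pow_sum p x.
Proof.
rewrite /pow_sum nneseries_recl//; last by move=> k _; rewrite lee_fin powR_ge0.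
have -> : normc (shiftr x 0%N) = 0 by exact: normc0.
rewrite powR0 ?gt_eqF// add0e -nneseries_addn; last first.
  by move=> k; rewrite lee_fin powR_ge0.
by apply: eq_eseriesr => k _; rewrite addn1.
Qed.

Let pow_sum_shiftl x : (pow_sum p (shiftl x) <= pow_sum p x)%E.
Proof.
rewrite [leRHS]/pow_sum nneseries_recl//; last first.
  by move=> k _; rewrite lee_fin powR_ge0.
rewrite -nneseries_addn; last by move=> k; rewrite lee_fin powR_ge0.
under eq_eseriesr do rewrite addn1.
by rewrite leeDr// lee_fin powR_ge0.
Qed.

Let shiftr_ellp (x : ellp p1) : shiftr x \in ellp_pred p.
Proof. by rewrite inE pow_sum_shiftr; have := valP x; rewrite inE. Qed.

Let shiftl_ellp (x : ellp p1) : shiftl x \in ellp_pred p.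
Proof.
rewrite inE (le_lt_trans (pow_sum_shiftl _))//.
by have := valP x; rewrite inE.
Qed.

Lemma triband_seq_ellp s r (x : ellp p1) : triband_seq s r x \in ellp_pred p.
Proof.
rewrite triband_seqE.
have [z0 cl] := ellp_submod_closed p1.
apply: (cl s); first exact: shiftr_ellp.
apply: (cl r); first exact: valP.
by rewrite -[s *: _]addr0; apply: (cl s); first exact: shiftl_ellp.
Qed.

Definition triband (s r : R[i]) (x : ellp p1) : ellp p1 :=
  Ellp p1 (triband_seq_ellp s r x).

Lemma triband_is_linear s r : linear (triband s r).
Proof.
move=> a x y; apply/val_inj/funext => k /=; rewrite /triband_seq.
rewrite !fctE /= /GRing.scale/=.
by case: k => [|k] /=; ring.
Qed.

HB.instance Definition _ s r :=
  GRing.isLinear.Build R[i] (ellp p1) (ellp p1) _ (triband s r)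
    (triband_is_linear s r).

Lemma triband_bounded s r (x : ellp p1) :
  `|triband s r x| <= (`|s| + `|r| + `|s|) * `|x|.
Proof.
pose xr : ellp p1 := Ellp p1 (shiftr_ellp x).
pose xl : ellp p1 := Ellp p1 (shiftl_ellp x).
have nr : `|xr| = `|x|.
  suff : ellp_norm xr = ellp_norm x by [].
  by rewrite /ellp_norm /normp pow_sum_shiftr.
have nl : `|xl| <= `|x|.
  suff : ellp_norm xl <= ellp_norm x by [].
  rewrite /ellp_norm lecR; apply: normp_le; [exact: p0| |].
  - exact: pow_sum_shiftl.
  - exact: valP.
have -> : triband s r x = s *: xr + (r *: x + s *: xl).
  by apply/val_inj; rewrite /= triband_seqE.
apply: (le_trans (ler_normD _ _)); apply: (le_trans (lerD (lexx _) (ler_normD _ _))).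
rewrite !normrZ nr.
move: nl; move: (`|xl|) (`|x|) (normr_ge0 s) => u v s0 uv.
have -> : (`|s| + `|r| + `|s|) * v = `|s| * v + (`|r| * v + `|s| * v) by ring.
by rewrite !lerD2l; exact: ler_wpM2l.
Qed.

Lemma triband_continuous s r : continuous (triband s r).
Proof.
apply: bounded_linear_continuous; apply/linear_boundedP.
near=> M => x; apply: le_trans (triband_bounded s r x) _.
by rewrite ler_wpM2r//; near: M; apply: nbhs_pinfty_ge; rewrite !rpredD// ger0_real.
Unshelve. all: by end_near. Qed.

End triband.

(* The eigenvalues of T: those lambda for which (T - lambda I)^-1 does not
   exist because T - lambda I is not injective. *)
Definition point_spectrum (K : numFieldType) (X : normedModType K)
    (T : {linear X -> X}) : set K :=
  [set lambda | ~ injective (fun x : X => T x - lambda *: x)].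

(* Main.v *)
(* If (U - lambda) x = 0 and q = (lambda - r) / s, then
   x_(k+2) = q x_(k+1) - x_k with x_1 = q x_0.  This recurrence conserves the
   quadratic form x_k^2 - q x_k x_(k+1) + x_(k+1)^2, whose initial value is
   x_0^2.  Since x is in ell_p its entries tend to 0, so the conserved value
   is 0; hence x_0 = 0, and then x = 0. *)
Require Import Defs.
From mathcomp Require Import all_boot all_order all_algebra.
From mathcomp Require Import complex.
From mathcomp Require Import all_classical all_reals all_analysis.
From mathcomp Require Import ring.

Set Implicit Arguments.
Unset Strict Implicit.
Unset Printing Implicit Defensive.

Import Order.TTheory GRing.Theory Num.Theory.
Import numFieldNormedType.Exports.

Local Open Scope classical_set_scope.
Local Open Scope ring_scope.
Local Open Scope complex_scope.

(** The partial sums of the [p]-th powers are nondecreasing and bounded by the finite [pow_sum p x],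
    so their series converges and its terms tend to 0. *)
Lemma pow_sum_lty_cvg0 (R : realType) (p : R) (x : nat -> R[i]^o) :
  0 < p -> (pow_sum p x < +oo)%E -> Normc.normc (x k) @[k --> \oo] --> 0.
Proof.
move=> p0 xfin; pose u k : R := Normc.normc (x k) `^ p.
have u_cvg0 : u @ \oo --> 0.
  apply: cvg_series_cvg_0; apply: nondecreasing_is_cvgn.
    by apply: nondecreasing_series => k _ _; exact: powR_ge0.
  exists (fine (pow_sum p x)) => _ [n _ <-].
  rewrite -lee_fin fineK ?ge0_fin_numE ?pow_sum_ge0// /series/= -sumEFin.
  by apply: nneseries_lim_ge => k _ _; rewrite lee_fin powR_ge0.
apply/cvgrPdist_lt => e e0; near=> k.
rewrite sub0r normrN ger0_norm ?normc_ge0//.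
have : u k < e `^ p.
  rewrite -[u k]ger0_norm ?powR_ge0//; near: k.
  by apply: (cvgr_norm_lt _ u_cvg0); rewrite normr0 powR_gt0.
rewrite !ltNge; apply: contra => ek.
by apply: ge0_ler_powR => //; rewrite ?nnegrE ?normc_ge0 ?(ltW e0) ?(ltW p0).
Unshelve. all: by end_near. Qed.

(** The roots of [t^2 - q t + 1] have product 1, whence a conserved quadratic form; using it avoids
    solving the recurrence and treating a double root apart. *)
Lemma recurrence_invariant (K : comPzRingType) (q : K) (x : nat -> K) :
  x 1%N = q * x 0%N -> (forall k, x k.+2 = q * x k.+1 - x k) ->
  forall k, x k ^+ 2 - q * x k * x k.+1 + x k.+1 ^+ 2 = x 0%N ^+ 2.
Proof.
move=> x1 xS; elim=> [|k <-]; first by rewrite x1; ring.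
by rewrite xS; ring.
Qed.

Lemma cvg0_recurrence_eq0 (R : realType) (q : R[i]) (x : nat -> R[i]) :
  x 1%N = q * x 0%N -> (forall k, x k.+2 = q * x k.+1 - x k) ->
  Normc.normc (x k) @[k --> \oo] --> 0 -> forall k, x k = 0.
Proof.
move=> x1 xS x_cvg0; pose a k : R := Normc.normc (x k).
have a_cvg0 : a @ \oo --> 0 by [].
have aS_cvg0 : a k.+1 @[k --> \oo] --> 0 by rewrite (cvg_shiftS a).
(* A real majorant of the modulus of the invariant, by the triangle inequality. *)
pose b k : R := a k * a k + Normc.normc q * a k * a k.+1 + a k.+1 * a k.+1.
have b_cvg0 : b @ \oo --> 0.
  have -> : 0 = 0 * 0 + Normc.normc q * 0 * 0 + 0 * 0 :> R by ring.
  apply: cvgD; last exact: cvgM.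
  apply: cvgD; first exact: cvgM.
  by do 2?[apply: cvgM => //]; exact: cvg_cst.
have x0_le k : a 0%N * a 0%N <= b k.
  rewrite /a -Normc.normcM -expr2 -(recurrence_invariant x1 xS k).
  rewrite (le_trans (normc_le _ _))// lerD// ?expr2 ?Normc.normcM//.
  rewrite (le_trans (normc_le _ _))// lerD// ?Normc.normcM//.
  by rewrite normcN !Normc.normcM.
have x00 : x 0%N = 0.
  apply: Normc.eq0_normc; apply/eqP; rewrite -[_ == 0]orbb -mulf_eq0 eq_le.
  rewrite mulr_ge0 ?normc_ge0// andbT.
  (* The constant lower bound [x0_le] passes to the limit 0 of [b]. *)
  rewrite -(cvg_lim (@Rhausdorff R) b_cvg0); apply: limr_ge.
    by apply: cvgP b_cvg0.
  by apply: nearW => k; exact: x0_le.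
suff xk k : x k = 0 /\ x k.+1 = 0 by move=> k; case: (xk k).
elim: k => [|k [xk xk1]]; first by rewrite x1 x00 mulr0.
by rewrite xS xk xk1 mulr0 subr0.
Qed.

(** Dividing by [s] turns the eigenvalue equation into the recurrence. For [s = 0] the operator is
    [r] times the identity, and [r] is an eigenvalue. *)
Lemma triband_eigenvector_eq0 (R : realType) (p : R) (p1 : 1 <= p)
    (r s lambda : R[i]) (z : ellp p1) :
  s != 0 -> triband s r z = lambda *: z -> z = 0.
Proof.
move=> s_neq0 Tz; have p0 : 0 < p := lt_le_trans ltr01 p1.
have Tzk k : s * (if k is j.+1 then ellp_seq z j else 0) + r * ellp_seq z k
    + s * ellp_seq z k.+1 = lambda * ellp_seq z k.
  by have := congr1 (fun t : ellp p1 => ellp_seq t k) Tz.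
pose q := (lambda - r) / s.
(* Row 0, where the entry of index -1 is 0, supplies the initial condition [x 1 = q * x 0]. *)
have zS k : ellp_seq z k.+1 =
    q * ellp_seq z k - (if k is j.+1 then ellp_seq z j else 0).
  apply: (mulfI s_neq0); rewrite mulrBr mulrA [s * q]mulrC divfK//.
  by rewrite mulrBl -Tzk; case: k => [|k]; ring.
apply/val_inj/funext => k.
apply: (@cvg0_recurrence_eq0 _ q (ellp_seq z)) => [|j|].
- by rewrite zS subr0.
- by rewrite zS.
by apply: (pow_sum_lty_cvg0 p0); have := valP z; rewrite inE.
Qed.

Theorem theorem3p3 (R : realType) (p : R) (p_gt1 : 1 < p)
    (r s : R[i]) (s_neq0 : s != 0) :
  point_spectrum (@triband R p (ltW p_gt1) s r) = set0.
Proof.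
apply/seteqP; split=> // lambda; apply=> x y Txy.
have Txy0 : triband s r (x - y) = lambda *: (x - y).
  apply/eqP; rewrite -subr_eq0 linearB scalerBr opprD addrACA -opprD.
  by rewrite subr_eq0; exact/eqP.
apply: subr0_eq; exact: triband_eigenvector_eq0 s_neq0 Txy0.
Qed.
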